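(* For each $r=0,1,\dots,m$ one has the decomposition $$A_r^\Gamma=\bigoplus_{j=0}^{\min(r,m-r)}D_+^{\,r-j}P_j^\Gamma.$$
   Context: Let $n$ be the number of vertices, $m=\binom n2$, $[m]=\{1,\dots,m\}$, and identify $[m]$ with the set of $2$-element subsets of $\{1,\dots,n\}$ (edges of $K_n$) via the lexicographic order. Each $\pi\in S_n$ permutes edges by $\{i,j\}\mapsto\{\pi(i),\pi(j)\}$; this gives a homomorphism $\varphi:S_n\to S_m$, whose image $\Gamma=\varphi(S_n)\subseteq S_m$ is the pair group. The graph algebra is $\mathcal A=\mathbb C[x_1,\dots,x_m]/(x_1^2-x_1,\dots,x_m^2-x_m)$, with vector space basis $\boldsymbol{x}_S=\prod_{e\in S}x_e$, $S\subseteq[m]$; $\Gamma$ acts linearly by $\gamma\cdot\boldsymbol{x}_S=\boldsymbol{x}_{\gamma(S)}$. For $0\le k\le m$, $A_k=\operatorname{span}_{\mathbb C}\{\boldsymbol{x}_S:|S|=k\}$, and $A_{-1}=0$. Linear operators: $D_+(\boldsymbol{x}_S)=\sum_{e\in[m]\setminus S}\boldsymbol{x}_{S\cup\{e\}}$ and $D_-(\boldsymbol{x}_S)=\sum_{e\in S}\boldsymbol{x}_{S\setminus\{e\}}$ (empty sums are zero); both commute with $\Gamma$. The primitive spaces are $P_k=\ker(D_-:A_k\to A_{k-1})$. For a $\Gamma$-module $W$, $W^\Gamma$ denotes the subspace of $\Gamma$-fixed vectors. The direct sum in the claim is an internal direct sum of subspaces of $A_r$. *)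

(* Defs.v *)
From HB Require Import structures.
From mathcomp Require Import all_boot all_order all_fingroup all_algebra.
From mathcomp Require Import ring_quotient.
From mathcomp Require Import boolp reals.
From mathcomp Require Import complex.
From mathcomp Require Import mpoly.

Set Implicit Arguments.
Unset Strict Implicit.
Unset Printing Implicit Defensive.

Import GRing.Theory.
Local Open Scope ring_scope.

(* The edges {i, j}, i < j, of K_n in lexicographic order of (i, j); [m] is   *)
(* 'I_('C(n, 2)), and e in [m] stands for the edge number e of this list.     *)

Definition edge_seq (n : nat) : seq {set 'I_n} :=
  [seq [set p.1; p.2] | p : 'I_n * 'I_n
     <- [seq q : 'I_n * 'I_n <- [seq (i, j) | i <- enum 'I_n, j <- enum 'I_n]
        | (q.1 < q.2)%N]].

Lemma mem_edge_seq n (E : {set 'I_n}) : (E \in edge_seq n) = (#|E| == 2).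
Proof.
apply/mapP/idP => [[[i j] /=]|/cards2P[i [j [neq_ij ->]]]].
  by rewrite mem_filter /= => /andP[lt_ij _] ->; rewrite cards2 -val_eqE neq_ltn lt_ij.
have mem_p (a b : 'I_n) : (a, b) \in [seq (i, j) | i <- enum 'I_n, j <- enum 'I_n].
  by apply/allpairsP; exists (a, b); rewrite !mem_enum.
move: neq_ij; rewrite -val_eqE neq_ltn => /orP[lt_ij|lt_ji].
  by exists (i, j); rewrite // mem_filter mem_p andbT.
by exists (j, i); rewrite ?mem_filter ?mem_p ?andbT // setUC.
Qed.

Lemma edge_seq_uniq n : uniq (edge_seq n).
Proof.
rewrite map_inj_in_uniq.
  by apply/filter_uniq/allpairs_uniq; rewrite ?enum_uniq // => -[? ?] [? ?].
move=> [a b] [c d]; rewrite !mem_filter /= => /andP[lt_ab _] /andP[lt_cd _] eqE.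
have := set21 a b; rewrite eqE => /set2P ac; have := set22 a b; rewrite eqE => /set2P bd.
have := set21 c d; rewrite -eqE => /set2P ca; have := set22 c d; rewrite -eqE => /set2P db.
case: ac bd lt_ab lt_cd => -> [] -> //=; rewrite ?ltnn //.
by move=> h1 h2; have := ltn_trans h1 h2; rewrite ltnn.
Qed.

Lemma size_edge_seq n : size (edge_seq n) = 'C(n, 2).
Proof.
rewrite -[RHS](_ : #|[set E : {set 'I_n} | #|E| == 2]| = _); last first.
  by rewrite card_draws card_ord.
rewrite cardE; apply/perm_size/uniq_perm; rewrite ?edge_seq_uniq ?enum_uniq //.
by move=> E; rewrite mem_enum inE mem_edge_seq.
Qed.

Definition edge (n : nat) (e : 'I_('C(n, 2))) : {set 'I_n} :=
  nth set0 (edge_seq n) e.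

Lemma edge_inj n : injective (@edge n).
Proof.
move=> e f /eqP; rewrite nth_uniq ?size_edge_seq ?edge_seq_uniq //.
by move/eqP/val_inj.
Qed.

Lemma card_edge n (e : 'I_('C(n, 2))) : #|edge e| = 2.
Proof. by apply/eqP; rewrite -mem_edge_seq mem_nth // size_edge_seq. Qed.

Lemma edge_onto n (E : {set 'I_n}) : #|E| = 2 -> exists e, edge e = E.
Proof.
move=> /eqP; rewrite -mem_edge_seq => /(nthP set0)[k].
by rewrite size_edge_seq => lt_k <-; exists (Ordinal lt_k).
Qed.

(* The default value e is never taken: see edge_pair_fun.                     *)

Definition pair_fun (n : nat) (s : 'S_n) (e : 'I_('C(n, 2))) : 'I_('C(n, 2)) :=
  odflt e [pick f | edge f == s @: edge e].

Lemma edge_pair_fun n (s : 'S_n) e : edge (pair_fun s e) = s @: edge e.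
Proof.
rewrite /pair_fun; case: pickP => [f /eqP //|none].
have [f def_f] : exists f, edge f = s @: edge e.
  by apply: edge_onto; rewrite card_imset ?card_edge //; apply: perm_inj.
by have := none f; rewrite def_f eqxx.
Qed.

Lemma pair_fun_inj n (s : 'S_n) : injective (pair_fun s).
Proof.
move=> e f eq_ef; apply/edge_inj/(imset_inj (@perm_inj _ s)).
by rewrite -!edge_pair_fun eq_ef.
Qed.

Definition pair_perm (n : nat) (s : 'S_n) : 'S_('C(n, 2)) :=
  perm (@pair_fun_inj n s).

Lemma edge_pair_perm n (s : 'S_n) e : edge (pair_perm s e) = s @: edge e.
Proof. by rewrite permE edge_pair_fun. Qed.

(* (s * t) i = t (s i) in 'S_n: products compose from left to right, in 'S_n  *)
(* and 'S_m alike, so that neither the image of pair_perm nor its fixed       *)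
(* vectors depend on this convention.                                         *)
Lemma pair_permM n :
  {in [set: 'S_n] &, {morph @pair_perm n : s t / (s * t)%g >-> (s * t)%g}}.
Proof.
move=> s t _ _; apply/permP=> e; apply: edge_inj.
rewrite permM !edge_pair_perm -imset_comp; apply: eq_imset => i.
by rewrite /= permM.
Qed.

Canonical pair_morphism n := Morphism (@pair_permM n).

Definition pair_group (n : nat) : {group 'S_('C(n, 2))} :=
  (pair_morphism n @* [set: 'S_n])%G.

Section GraphAlgebra.

Variables (K : fieldType) (n : nat).

Local Notation m := 'C(n, 2).

Definition graph_ideal (p : {mpoly K[m]}) : bool :=
  `[< exists q : 'I_m -> {mpoly K[m]},
        p = \sum_(e < m) q e * ('X_e ^+ 2 - 'X_e) >].

Fact graph_ideal_closed : idealr_closed graph_ideal.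
Proof.
split.
- by apply/asboolP; exists (fun=> 0); rewrite big1 // => e _; rewrite mul0r.
- apply/asboolP => -[q /(congr1 (meval (fun=> 0 : K)))].
  rewrite rmorph1 rmorph_sum big1 => [/eqP|e _]; first by rewrite oner_eq0.
  by rewrite /= mevalM mevalB rmorphXn /= mevalXU expr0n subrr mulr0.
- move=> a u v /asboolP[p ->] /asboolP[q ->]; apply/asboolP.
  exists (fun e => a * p e + q e); rewrite mulr_sumr -big_split /=.
  by apply: eq_bigr => e _; rewrite mulrDl mulrA.
Qed.

HB.instance Definition _ :=
  isIdealr.Build {mpoly K[m]} graph_ideal graph_ideal_closed.

Definition graph_idealr : idealr {mpoly K[m]} := graph_ideal.

Definition graph_alg := {ideal_quot graph_idealr}.

HB.instance Definition _ := GRing.ComNzRing.on graph_alg.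

Definition graph_pi (p : {mpoly K[m]}) : graph_alg :=
  (\pi_({ideal_quot graph_idealr}) p)%qT.

HB.instance Definition _ := GRing.RMorphism.copy graph_pi
  (\pi_({ideal_quot graph_idealr}))%qT.

Lemma graph_pi_eq0 p : (graph_pi p == 0) = graph_ideal p.
Proof. by rewrite -(rmorph0 graph_pi) /graph_pi -Quotient.idealrBE subr0. Qed.

Lemma graph_pi_onto (v : graph_alg) : exists p, graph_pi p = v.
Proof. by exists (generic_quotient.repr v); rewrite /graph_pi reprK. Qed.

Definition graph_scale (a : K) (v : graph_alg) : graph_alg :=
  graph_pi a%:MP * v.

Fact graph_scaleA a b v :
  graph_scale a (graph_scale b v) = graph_scale (a * b) v.
Proof. by rewrite /graph_scale mpolyCM rmorphM mulrA. Qed.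

Fact graph_scale1 : left_id 1 graph_scale.
Proof. by move=> v; rewrite /graph_scale mpolyC1 rmorph1 mul1r. Qed.

Fact graph_scaleDr : right_distributive graph_scale +%R.
Proof. by move=> a u v; rewrite /graph_scale mulrDr. Qed.

Fact graph_scaleDl v : {morph graph_scale^~ v : a b / a + b}.
Proof. by move=> a b; rewrite /graph_scale mpolyCD rmorphD mulrDl. Qed.

HB.instance Definition _ := GRing.Zmodule_isLmodule.Build K graph_alg
  graph_scaleA graph_scale1 graph_scaleDr graph_scaleDl.

Fact graph_scaleAl (a : K) (u v : graph_alg) : a *: (u * v) = (a *: u) * v.
Proof. exact: mulrA. Qed.

HB.instance Definition _ :=
  GRing.Lmodule_isLalgebra.Build K graph_alg graph_scaleAl.

Fact graph_scaleAr (a : K) (u v : graph_alg) : a *: (u * v) = u * (a *: v).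
Proof. exact: mulrCA. Qed.

HB.instance Definition _ :=
  GRing.Lalgebra_isAlgebra.Build K graph_alg graph_scaleAr.

Lemma graph_piZ (a : K) p : graph_pi (a *: p) = a *: graph_pi p.
Proof. by rewrite -mul_mpolyC rmorphM. Qed.

Definition gvar (e : 'I_m) : graph_alg := graph_pi 'X_e.

Lemma gvar_idem e : gvar e ^+ 2 = gvar e.
Proof.
apply/eqP; rewrite -subr_eq0 -rmorphXn -rmorphB graph_pi_eq0.
apply/asboolP; exists (fun f => (f == e)%:R).
rewrite (bigD1 e) //= eqxx mul1r big1 ?addr0 // => f /negPf->.
by rewrite mul0r.
Qed.

(* The basis vector x_S; see gmon_basisP.                                     *)
Definition gmon (S : {set 'I_m}) : graph_alg := \prod_(e in S) gvar e.

Lemma graph_pi_mon (k : 'X_{1..m}) :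
  graph_pi 'X_[k] = gmon [set e | k e != 0].
Proof.
rewrite mpolyXE_id rmorph_prod /gmon [RHS]big_mkcond; apply: eq_bigr => e _ /=.
rewrite inE rmorphXn -/(gvar e); case: (k e) => //= j.
by elim: j => // j IHj; rewrite exprS IHj -expr2 gvar_idem.
Qed.

Local Notation N := #|{: {set 'I_m}}|.

Let gcomb (r : 'rV[K]_N) : graph_alg :=
  \sum_(S : {set 'I_m}) r 0 (enum_rank S) *: gmon S.

Let gcomb_is_linear : linear gcomb.
Proof.
move=> a r s; rewrite /gcomb scaler_sumr -big_split; apply: eq_bigr => S _.
by rewrite !mxE scalerDl scalerA.
Qed.

Let gcomb_onto v : exists r, gcomb r == v.
Proof.
have [p <-] := graph_pi_onto v.
elim/mpolyind: p => [|a k p _ _ [r /eqP def_r]].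
  exists 0; rewrite rmorph0 /gcomb big1 // => S _; by rewrite mxE scale0r.
exists (a *: delta_mx 0 (enum_rank [set e | k e != 0]) + r).
rewrite gcomb_is_linear def_r rmorphD /= graph_piZ graph_pi_mon; apply/eqP.
congr (_ *: _ + _); rewrite /gcomb (bigD1 [set e | k e != 0]) //= mxE !eqxx.
rewrite scale1r big1 ?addr0 // => S neqS.
by rewrite mxE (inj_eq enum_rank_inj) (negPf neqS) andbF scale0r.
Qed.

Let gcomb_inj : injective gcomb.
Proof.
suffices inj0 r : gcomb r = 0 -> r = 0.
  move=> r s eq_rs; apply/eqP; rewrite -subr_eq0; apply/eqP/inj0.
  by rewrite addrC -scaleN1r gcomb_is_linear eq_rs scaleN1r addNr.
move=> r0; have sum0 (T : {set 'I_m}) :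
    \sum_(S : {set 'I_m} | S \subset T) r 0 (enum_rank S) = 0.
  pose p : {mpoly K[m]} :=
    \sum_(S : {set 'I_m}) r 0 (enum_rank S) *: \prod_(e in S) 'X_e.
  have: graph_ideal p.
    rewrite -graph_pi_eq0 -r0 /p raddf_sum; apply/eqP/eq_bigr => S _.
    by rewrite /= graph_piZ rmorph_prod.
  pose ev := meval (fun e => (e \in T)%:R : K).
  move/asboolP=> [q /(congr1 ev)]; rewrite /ev /p !raddf_sum [X in _ = X]big1; last first.
    move=> e _; rewrite /= mevalM mevalB rmorphXn /= mevalXU.
    by case: (e \in T); rewrite ?expr1n ?expr0n subrr mulr0.
  move=> ev0; rewrite -[RHS]ev0 big_mkcond; apply: eq_bigr => S _ /=.
  rewrite mevalZ rmorph_prod /=; case: ifPn => [/subsetP sST | /subsetPn[e eS eT]].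
    by rewrite big1 ?mulr1 // => e /sST eT; rewrite mevalXU eT.
  by rewrite (bigD1 e) //= mevalXU (negPf eT) mul0r mulr0.
apply/rowP=> i; rewrite mxE -(enum_valK i); move: (enum_val i) => {i} T.
have [k leTk] := ubnP #|T|; elim: k T leTk => // k IHk T leTk.
have := sum0 T; rewrite (bigD1 T) //= big1 ?addr0 // => S /andP[sST neST].
by apply: IHk; rewrite (leq_trans (proper_card _) leTk) // properEneq neST.
Qed.

Let gcoord v : 'rV[K]_N := xchoose (gcomb_onto v).

Let gcoordK : cancel gcoord gcomb.
Proof. by move=> v; apply/eqP/(xchooseP (gcomb_onto v)). Qed.

Fact graph_alg_vect_iso : Vector.axiom N graph_alg.
Proof.
have gcombK : cancel gcomb gcoord by move=> r; apply: gcomb_inj; rewrite gcoordK.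
exists gcoord; last by exists gcomb.
by move=> a u v; apply: gcomb_inj; rewrite gcomb_is_linear !gcoordK.
Qed.

HB.instance Definition _ := Lmodule_hasFinDim.Build K graph_alg graph_alg_vect_iso.

Definition gmon_basis : N.-tuple graph_alg := [tuple gmon (enum_val i) | i < N].

Lemma gmon_basisP : basis_of {:graph_alg} gmon_basis.
Proof.
rewrite basisEdim dimvf size_tuple leqnn andbT.
apply/subvP=> v _; have [r /eqP <-] := gcomb_onto v.
apply: memv_suml => S _; apply/memvZ/memv_span/tnthP.
by exists (enum_rank S); rewrite tnth_mktuple enum_rankK.
Qed.

(* The linear operator with prescribed values on the basis gmon.              *)

Definition gextend (f : {set 'I_m} -> graph_alg) : 'End(graph_alg) :=
  linfun (fun v => \sum_(S : {set 'I_m}) coord gmon_basis (enum_rank S) v *: f S).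

Lemma gextendE f S : gextend f (gmon S) = f S.
Proof.
pose F v := \sum_(S : {set 'I_m}) coord gmon_basis (enum_rank S) v *: f S.
have F_lin : linear F.
  move=> a u v; rewrite /F scaler_sumr -big_split; apply: eq_bigr => T _.
  by rewrite linearP scalerDl scalerA.
pose FL := GRing.isLinear.Build K graph_alg graph_alg *:%R F F_lin.
pose Flin : {linear graph_alg -> graph_alg} := HB.pack F FL.
rewrite /gextend (lfunE Flin) /= /F.
have gmonE : gmon S = gmon_basis`_(enum_rank S).
  by rewrite -tnth_nth tnth_mktuple enum_rankK.
rewrite (bigD1 S) //= gmonE coord_free ?(basis_free gmon_basisP) // eqxx scale1r.
rewrite big1 ?addr0 // => T neqTS; rewrite coord_free ?(basis_free gmon_basisP) //.
by rewrite (inj_eq enum_rank_inj) eq_sym (negPf neqTS) scale0r.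
Qed.

Definition graph_act (g : 'S_m) : 'End(graph_alg) := gextend (fun S => gmon (g @: S)).

Definition D_plus : 'End(graph_alg) :=
  gextend (fun S => \sum_(e in ~: S) gmon (e |: S)).

Definition D_minus : 'End(graph_alg) :=
  gextend (fun S => \sum_(e in S) gmon (S :\ e)).

Definition D_plus_iter (k : nat) : 'End(graph_alg) :=
  iter k (comp_lfun D_plus) \1%VF.

Definition hom_space (k : nat) : {vspace graph_alg} :=
  <<[seq gmon T | T in [set T : {set 'I_m} | #|T| == k]]>>%VS.

(* D_minus maps A_k into A_(k-1), and A_0 to 0: this is the kernel of its     *)
(* restriction to A_k.                                                        *)
Definition prim_space (k : nat) : {vspace graph_alg} :=
  (hom_space k :&: lker D_minus)%VS.

Definition inv_space (W : {vspace graph_alg}) : {vspace graph_alg} :=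
  (W :&: \bigcap_(g in pair_group n) fixedSpace (graph_act g))%VS.

End GraphAlgebra.

(* Main.v *)
Require Import Defs.
From mathcomp Require Import all_boot all_order all_fingroup all_algebra.
From mathcomp Require Import reals complex.
From mathcomp Require Import ring zify.

(** Counting how an edge can be added and then removed, or removed and then
    added, gives [D_-, D_+] = m - 2k on A_k: the two operators generate a
    representation of sl_2 on the graph algebra, with A_k in weight m - 2k.  The
    claim is the decomposition of such a representation into strings
    p, D_+ p, D_+^2 p, ... issued from the primitive vectors p.  As D_+ and D_-
    commute with the group, they restrict to the invariants A_k^Gamma, and the
    primitive vectors of that smaller graded space are exactly the P_k^Gamma.
    So the decomposition is proved for an arbitrary graded space with such a
    pair of operators ([lefschetz_decomposition]), then applied to the graded
    space of invariants.

    Everything in the abstract part rests on the string formula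
    ([down_iter_up]): on A_j, the commutator of D with U^k is
    k (m + 1 - 2j - k) U^(k-1).  In characteristic zero this scalar vanishes,
    for k > 0, only when k = m + 1 - 2j.

    - Above the middle degree it never vanishes, so U D is injective there
      ([up_down_eq0]): if U D v = 0 then U^k v = 0 implies U^(k-1) v = 0, and
      U^k v is 0 once it lies above the top degree.  Hence there are no
      nonzero primitive vectors above the middle, and the string of a primitive vector
      of degree j stops at degree m - j.

    - The strings span ([primitive_expansion]), by induction on the degree: D v
      expands along strings, each of its terms is lifted one step up its string
      by dividing by the scalar, and the difference w between v and these lifts
      is primitive.  The terms that cannot be lifted, those whose scalar is
      zero, sit at the very end of their strings, so that U D w = 0, and they
      only occur above the middle, where this forces w = 0.

    - The sum is direct because the summand of index j in A_r lies in the
      eigenspace of U D for the scalar of (j, r - j), and these scalars are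
      pairwise distinct when j <= min(r, m - r).                               *)

Set Implicit Arguments.
Unset Strict Implicit.
Unset Printing Implicit Defensive.

Import GRing.Theory.
Local Open Scope ring_scope.

(** * Linear algebra *)

Lemma pchar0_natr_inj (K : fieldType) :
  [pchar K] =i pred0 -> injective (fun n => n%:R : K).
Proof.
move=> /pcharf0P char0 a b; wlog le_ab : a b / (a <= b)%N.
  by move=> IH eq_ab; case/orP: (leq_total a b) => /IH; [exact | move=> ->].
move=> /esym/eqP; rewrite -subr_eq0 -natrB // char0 subn_eq0 => le_ba.
by apply/eqP; rewrite eqn_leq le_ab.
Qed.

(** Induction on the number of eigenvectors: applying f - c i to the relation
    removes u i and only rescales the other vectors by nonzero factors.       *)
Lemma eigenvectors_independent (K : fieldType) (vT : vectType K)
    (f : 'End(vT)) (I : finType) (c : I -> K) (A : {set I}) (u : I -> vT) :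
  injective c -> (forall i, f (u i) = c i *: u i) ->
  \sum_(i in A) u i = 0 -> {in A, forall i, u i = 0}.
Proof.
move=> c_inj; have [k leAk] := ubnP #|A|.
elim: k => // k IHk in A leAk u * => fu sum_u i Ai.
pose u' j := (c j - c i) *: u j.
have u'0 : {in A :\ i, forall j, u' j = 0}.
  apply: IHk => [|j|].
  - by move: leAk; rewrite (cardsD1 i) Ai.
  - by rewrite linearZ /= fu !scalerA mulrC.
  transitivity (\sum_(j in A) u' j).
    rewrite [RHS](bigD1 i) //= /u' subrr scale0r add0r.
    by apply: eq_bigl => j; rewrite in_setD1 andbC.
  transitivity (f (\sum_(j in A) u j) - c i *: \sum_(j in A) u j).
    rewrite linear_sum scaler_sumr -sumrB.
    by apply: eq_bigr => j _; rewrite /= fu -scalerBl.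
  by rewrite sum_u linear0 scaler0 subrr.
rewrite -sum_u (bigD1 i) //= big1 ?addr0 // => j /andP[Aj neq_ji].
have /u'0/eqP : j \in A :\ i by rewrite in_setD1 neq_ji.
by rewrite scaler_eq0 subr_eq0 (inj_eq c_inj) (negPf neq_ji) => /eqP.
Qed.

Lemma iter_comp_lfunE (K : fieldType) (vT : vectType K) (f : 'End(vT)) k v :
  iter k (comp_lfun f) \1%VF v = iter k f v.
Proof. by elim: k => [|k IHk]; rewrite /= ?id_lfunE // comp_lfunE IHk. Qed.

Lemma iter_lfun0 (K : fieldType) (vT : vectType K) (f : 'End(vT)) k :
  iter k f 0 = 0.
Proof. by elim: k => //= k ->; rewrite linear0. Qed.

(** * Strings of a raising and a lowering operator *)

Section Lefschetz.

Variables (K : fieldType) (vT : vectType K) (m : nat).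
Variables (A : nat -> {vspace vT}) (U D : 'End(vT)).

Hypothesis K0 : [pchar K] =i pred0.
Hypothesis A_up : forall k v, v \in A k -> U v \in A k.+1.
Hypothesis A_down : forall k v, v \in A k.+1 -> D v \in A k.
Hypothesis A_bottom : forall v, v \in A 0%N -> D v = 0.
Hypothesis A_top : forall k, (m < k)%N -> A k = 0%VS.
Hypothesis commDU : forall k v, v \in A k ->
  D (U v) = U (D v) + (m%:R - k.*2%:R) *: v.

(** Written as k (m + 1 - (2j + k)) so that its zeros are read off a comparison
    of natural numbers.                                                       *)
Definition lower_coef j k : K := k%:R * (m.+1%:R - (j.*2 + k)%:R).

Lemma lower_coef_eq0 j k :
  (lower_coef j k == 0) = (k == 0%N) || (j.*2 + k == m.+1)%N.
Proof.
rewrite mulf_eq0 (pcharf0P _).1 // subr_eq0 [m.+1%:R == _]eq_sym.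
by rewrite (inj_eq (pchar0_natr_inj K0)).
Qed.

Lemma iter_up k j v : v \in A j -> iter k U v \in A (k + j).
Proof. by move=> Av; elim: k => //= k; apply: A_up. Qed.

(** The scalars m - 2(j + i), i < k, picked up while D moves to the right across
    the factors of U^k, add up to the coefficient.  For k = 0 the power k.-1 is
    harmless, as the coefficient is then zero.                                *)
Lemma down_iter_up k j v : v \in A j ->
  D (iter k U v) = iter k U (D v) + lower_coef j k *: iter k.-1 U v.
Proof.
move=> Av; elim: k => [|k IHk]; first by rewrite /lower_coef mul0r scale0r addr0.
rewrite iterS (commDU (iter_up k Av)) IHk linearD linearZ /= -addrA; congr (_ + _).
have -> : lower_coef j k *: U (iter k.-1 U v) = lower_coef j k *: iter k U v.
  by case: k {IHk} => // ; rewrite /lower_coef mul0r !scale0r.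
rewrite -scalerDl; congr (_ *: _); rewrite /lower_coef -!mul2n; ring.
Qed.

(** In degrees above m / 2 the scalars of the string formula are nonzero for k > 0,
    so one can descend from U^(m+1) v = 0 to v = 0.  The hypothesis U (D v) = 0,
    weaker than D v = 0, already makes D (U^(k+1) v) a multiple of U^k v.     *)
Lemma up_down_eq0 r v : (m < r.*2)%N -> v \in A r -> U (D v) = 0 -> v = 0.
Proof.
move=> lt_m2r Av UDv0.
have down k : iter k.+1 U v = 0 -> iter k U v = 0.
  move=> Uv0; have := down_iter_up k.+1 Av.
  rewrite Uv0 linear0 iterSr UDv0 => /esym/eqP.
  rewrite iter_lfun0 add0r scaler_eq0 lower_coef_eq0 /= => /orP[/eqP|/eqP//]; lia.
have: iter m.+1 U v = 0.
  by apply/eqP; rewrite -memv0 -(A_top (ltn_addr r (ltnSn m))) iter_up.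
by elim: m.+1 => // k IHk /down.
Qed.

Lemma prim_above_middle j p : (m < j.*2)%N -> p \in (A j :&: lker D)%VS -> p = 0.
Proof.
move=> lt_m2j /memv_capP[Ap]; rewrite memv_ker => /eqP Dp0.
by apply: (up_down_eq0 lt_m2j Ap); rewrite Dp0 linear0.
Qed.

Lemma down_iter_up_prim k j p : p \in (A j :&: lker D)%VS ->
  D (iter k U p) = lower_coef j k *: iter k.-1 U p.
Proof.
move=> /memv_capP[Ap]; rewrite memv_ker => /eqP Dp0.
by rewrite (down_iter_up k Ap) Dp0 iter_lfun0 add0r.
Qed.

(** With k0 = m + 1 - 2j the scalar vanishes, so U^k0 p is again primitive; its
    degree m + 1 - j is above the middle.  If 2j > m then the truncated k0 is 0
    and the same reasoning applies to p itself.                               *)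
Lemma iter_up_prim_eq0 k j p :
  (m < j.*2 + k)%N -> p \in (A j :&: lker D)%VS -> iter k U p = 0.
Proof.
move=> lt_m Pp; pose k0 := (m.+1 - j.*2)%N.
have /prim_above_middle U0 : iter k0 U p \in (A (k0 + j) :&: lker D)%VS.
  have /memv_capP[Ap _] := Pp.
  rewrite memv_cap iter_up // memv_ker (down_iter_up_prim k0 Pp).
  suffices /eqP-> : lower_coef j k0 == 0 by rewrite scale0r eqxx.
  by rewrite lower_coef_eq0 /k0; lia.
rewrite -(@subnK k0 k) ?iterD ?U0 /k0; try lia.
exact: iter_lfun0.
Qed.

(** Here j ranges up to r and not only up to min(r, m - r); the additional terms
    are zero by [iter_up_prim_eq0], but keeping them makes the induction uniform
    below and above the middle degree.                                        *)
Lemma primitive_expansion r v : v \in A r ->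
  exists2 p : nat -> vT, forall j, p j \in (A j :&: lker D)%VS
    & v = \sum_(j < r.+1) iter (r - j) U (p j).
Proof.
elim: r v => [|r IHr] v Av.
  exists (fun j => if j == 0%N then v else 0) => [[|j]|]; rewrite ?mem0v //.
    by rewrite memv_cap Av memv_ker A_bottom ?eqxx.
  by rewrite big_ord1.
have [p Pp Dv] := IHr _ (A_down Av).
pose c j := lower_coef j (r.+1 - j).
pose w := v - \sum_(j < r.+1) (c j)^-1 *: iter (r.+1 - j) U (p j).
have Aup (j : nat) : (j <= r.+1)%N -> iter (r.+1 - j) U (p j) \in A r.+1.
  move=> le_j; have /memv_capP[Ap _] := Pp j.
  by have := iter_up (r.+1 - j) Ap; rewrite subnK.
have Aw : w \in A r.+1.
  by apply/rpredB/rpred_sum => // j _; apply/rpredZ/Aup/ltnW.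
(* As 0^-1 = 0, the terms with c j = 0 contribute nothing to the correction. *)
have Dw : D w = \sum_(j < r.+1 | c j == 0) iter (r - j) U (p j).
  rewrite linearB linear_sum /= Dv -sumrB [RHS]big_mkcond; apply: eq_bigr => j _.
  rewrite linearZ /= (down_iter_up_prim _ (Pp j)) -/(c j) scalerA.
  rewrite subSn ?leq_ord //=; have [->|nz_c] := eqVneq (c j) 0.
    by rewrite mulr0 scale0r subr0.
  by rewrite mulVf // scale1r subrr.
have c_eq0 (j : 'I_r.+1) : c j = 0 -> (j.*2 + (r.+1 - j) = m.+1)%N.
  move/eqP; rewrite lower_coef_eq0 subn_eq0 leqNgt ltnS leq_ord /=.
  by move/eqP.
have Dw0 : D w = 0.
  have [le_rm|lt_mr] := leqP r.+1.*2 m.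
    rewrite Dw big1 // => j /eqP/c_eq0; have := ltn_ord j; lia.
  suffices -> : w = 0 by rewrite linear0.
  apply: (up_down_eq0 lt_mr Aw); rewrite Dw linear_sum big1 // => j /eqP/c_eq0 eq_m.
  rewrite -[LHS]/(iter (r - j).+1 U (p j)) -subSn ?leq_ord //.
  by apply: (@iter_up_prim_eq0 _ j); rewrite ?eq_m.
exists (fun j => if j == r.+1 then w else if (j <= r)%N then (c j)^-1 *: p j else 0).
  move=> j; case: eqP => [->|_]; first by rewrite memv_cap Aw memv_ker Dw0 eqxx.
  by case: leqP => _; rewrite ?mem0v ?rpredZ.
rewrite big_ord_recr /= eqxx subnn /= addrC -[LHS](subrK (v - w)) subKr.
congr (_ + _); rewrite subKr; apply: eq_bigr => j _.
rewrite ltn_eqF ?ltn_ord // leq_ord.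
by elim: (r.+1 - j)%N => //= i <-; rewrite linearZ.
Qed.

(** The bound j <= m - r keeps the strings that reach degree r.  On this range
    2j + (r - j) <= m, so the eigenvalues of U D on the summands are the natural
    numbers (r - j)(m + 1 - r - j), strictly decreasing in j.                 *)
Lemma lefschetz_decomposition r : (r <= m)%N ->
  A r = (\sum_(j < (minn r (m - r)).+1)
           iter (r - j) (comp_lfun U) \1%VF @: (A j :&: lker D))%VS
  /\ directv (\sum_(j < (minn r (m - r)).+1)
           iter (r - j) (comp_lfun U) \1%VF @: (A j :&: lker D))%VS.
Proof.
move=> le_rm; split.
  apply/eqP; rewrite eqEsubv; apply/andP; split; last first.
    apply/subv_sumP => j _; apply/subvP => _ /memv_imgP[p /memv_capP[Ap _] ->].
    rewrite iter_comp_lfunE; have := iter_up (r - j) Ap; rewrite subnK //.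
    by have := ltn_ord j; lia.
  apply/subvP => v /primitive_expansion[p Pp ->].
  apply: memv_suml => j _; have [lt_mj|le_jm] := ltnP m (j.*2 + (r - j)).
    by rewrite (iter_up_prim_eq0 lt_mj (Pp j)) mem0v.
  have lt_j : (j < (minn r (m - r)).+1)%N by have := ltn_ord j; lia.
  apply: (subvP (sumv_sup (Ordinal lt_j) isT (subvv _))).
  by rewrite -iter_comp_lfunE memv_img.
apply/directv_sum_independent => u Uu sum_u i _.
pose c (j : 'I_(minn r (m - r)).+1) := lower_coef j (r - j).
have c_inj : injective c.
  have cE j : c j = ((r - j) * (m.+1 - (j.*2 + (r - j))))%N%:R.
    by rewrite natrM [(m.+1 - _)%:R]natrB //; have := ltn_ord j; lia.
  move=> j1 j2; rewrite !cE => /(pchar0_natr_inj K0) eq_c; apply: val_inj => /=.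
  have := ltn_ord j1; have := ltn_ord j2; nia.
have eig j : (U \o D)%VF (u j) = c j *: u j.
  have /memv_imgP[p Pp ->] := Uu j isT.
  rewrite iter_comp_lfunE comp_lfunE (down_iter_up_prim _ Pp) linearZ /= -/(c j).
  rewrite /c; case: (r - j)%N => // ; rewrite /lower_coef mul0r !scale0r //.
apply: (eigenvectors_independent (A := setT) c_inj eig); rewrite ?inE //.
by rewrite -[RHS]sum_u; apply: eq_bigl => j; rewrite inE.
Qed.

End Lefschetz.

(** * The operators of the graph algebra *)

Section GraphOperators.

Variables (K : fieldType) (n : nat).

Local Notation m := 'C(n, 2).
Local Notation GA := (graph_alg K n).
Local Notation xmon := (@gmon K n).
Local Notation Dp := (D_plus K n).
Local Notation Dm := (D_minus K n).

Lemma D_plusE S : Dp (xmon S) = \sum_(e in ~: S) xmon (e |: S).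
Proof. exact: gextendE. Qed.

Lemma D_minusE S : Dm (xmon S) = \sum_(e in S) xmon (S :\ e).
Proof. exact: gextendE. Qed.

Lemma graph_actE g S : graph_act K g (xmon S) = xmon (g @: S).
Proof. exact: gextendE. Qed.

Lemma gmon_hom_space S : xmon S \in hom_space K n #|S|.
Proof. by apply/memv_span/map_f; rewrite mem_enum inE. Qed.

Lemma hom_space_subv k (W : {vspace GA}) :
  (forall S : {set 'I_m}, #|S| = k -> xmon S \in W) -> (hom_space K n k <= W)%VS.
Proof.
move=> WS; apply/span_subvP => v /mapP[S]; rewrite mem_enum inE => /eqP Sk ->.
exact: WS.
Qed.

Lemma eq_lfun_gmon (f g : 'End(GA)) :
  (forall S, f (xmon S) = g (xmon S)) -> f = g.
Proof.
move=> eq_fg; apply/lfunP => v.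
have /eqlfun_inP : (fullv <= lker (f - g))%VS; last by apply; rewrite memvf.
rewrite -(span_basis (gmon_basisP K n)); apply/span_subvP => _ /tnthP[i ->].
by rewrite tnth_mktuple; apply/eqlfunP.
Qed.

Lemma hom_space_above k : (m < k)%N -> hom_space K n k = 0%VS.
Proof.
move=> lt_mk; apply/eqP; rewrite -subv0; apply: hom_space_subv => S Sk.
by move: lt_mk; rewrite -Sk ltnNge -[X in (_ <= X)%N]card_ord max_card.
Qed.

Lemma D_plus_hom k v : v \in hom_space K n k -> Dp v \in hom_space K n k.+1.
Proof.
rewrite memv_preim; move: v; apply/subvP/hom_space_subv => S Sk; rewrite -memv_preim D_plusE.
apply: memv_suml => e; rewrite inE => eS.
by have := gmon_hom_space (e |: S); rewrite cardsU1 eS Sk.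
Qed.

Lemma D_minus_hom k v : v \in hom_space K n k.+1 -> Dm v \in hom_space K n k.
Proof.
rewrite memv_preim; move: v; apply/subvP/hom_space_subv => S Sk; rewrite -memv_preim D_minusE.
apply: memv_suml => e eS.
by move: Sk; rewrite (cardsD1 e) eS => -[<-]; apply: gmon_hom_space.
Qed.

Lemma D_minus_hom0 v : v \in hom_space K n 0 -> Dm v = 0.
Proof.
move=> Av; apply/eqP; rewrite -memv_ker; move: v Av.
apply/subvP/hom_space_subv => S /cards0_eq->.
by rewrite memv_ker D_minusE big_set0.
Qed.

(** In both products the terms that add e outside S and remove f in S agree.
    What remains is x_S: once for each e outside S, added then removed, in
    D_- D_+, and once for each f in S, removed then restored, in D_+ D_-.      *)
Lemma D_commutator k v : v \in hom_space K n k ->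
  Dm (Dp v) = Dp (Dm v) + (m%:R - k.*2%:R) *: v.
Proof.
pose f := (Dm \o Dp)%VF; pose g := (Dp \o Dm + (m%:R - k.*2%:R) *: \1)%VF.
suffices /eqlfun_inP fg : (hom_space K n k <= lker (f - g))%VS.
  by move/fg; rewrite /f /g !lfunE /= !lfunE /= !lfunE.
apply: hom_space_subv => S Sk; apply/eqlfunP; rewrite /f /g.
rewrite add_lfunE scale_lfunE id_lfunE !comp_lfunE D_plusE D_minusE !linear_sum /=.
pose X := \sum_(e in ~: S) \sum_(f in S) xmon (e |: (S :\ f)).
have -> : \sum_(e in ~: S) Dm (xmon (e |: S)) = X + (m - k)%:R *: xmon S.
  have <- : \sum_(e in ~: S) xmon S = (m - k)%:R *: xmon S.
    by rewrite sumr_const cardsCs setCK card_ord Sk scaler_nat.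
  rewrite -big_split; apply: eq_bigr => e; rewrite inE => eS /=.
  rewrite D_minusE big_setU1 //= setU1K // addrC; congr (_ + _).
  apply: eq_bigr => h hS; congr (xmon _); apply/setP=> i; rewrite !inE.
  by case: (eqVneq i e) => // ->; case: eqP eS => // ->; rewrite hS.
have -> : \sum_(e in S) Dp (xmon (S :\ e)) = X + k%:R *: xmon S.
  have <- : \sum_(e in S) xmon S = k%:R *: xmon S by rewrite sumr_const Sk scaler_nat.
  rewrite /X exchange_big -big_split; apply: eq_bigr => h hS /=.
  rewrite D_plusE setCD setUC big_setU1 ?inE ?hS //= addrC; congr (_ + _).
  by rewrite setD1K.
have le_km : (k <= m)%N by rewrite -Sk -[X in (_ <= X)%N]card_ord max_card.
rewrite -addrA -scalerDl; congr (_ + _ *: _).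
by rewrite natrB // -addnn natrD; ring.
Qed.

Lemma D_plus_act g v : Dp (graph_act K g v) = graph_act K g (Dp v).
Proof.
rewrite -!comp_lfunE; congr (fun_of_lfun _ _); apply: eq_lfun_gmon => S.
rewrite !comp_lfunE graph_actE !D_plusE linear_sum /= (reindex_inj (@perm_inj _ g)) /=.
apply: eq_big => [e|e _]; last by rewrite graph_actE imsetU1.
by rewrite !inE mem_imset //; apply: perm_inj.
Qed.

Lemma D_minus_act g v : Dm (graph_act K g v) = graph_act K g (Dm v).
Proof.
rewrite -!comp_lfunE; congr (fun_of_lfun _ _); apply: eq_lfun_gmon => S.
rewrite !comp_lfunE graph_actE !D_minusE linear_sum /= (reindex_inj (@perm_inj _ g)) /=.
apply: eq_big => [e|e _]; first by rewrite mem_imset //; apply: perm_inj.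
rewrite graph_actE; congr xmon; apply/setP=> i.
by rewrite -(permKV g i) !(in_setD1, mem_imset _ _ (@perm_inj _ g)) (inj_eq perm_inj).
Qed.

(** * Invariants *)

Lemma memv_inv (W : {vspace GA}) v :
  reflect (v \in W /\ {in pair_group n, forall g, graph_act K g v = v})
          (v \in inv_space W).
Proof.
rewrite memv_cap; apply: (iffP andP) => -[Wv]; rewrite memvE.
  by move/subv_bigcapP=> fix_v; split=> // g /fix_v; rewrite -memvE => /fixedSpaceP.
move=> fix_v; split=> //; apply/subv_bigcapP => g /fix_v gv.
by rewrite -memvE; apply/fixedSpaceP.
Qed.

Lemma inv_prim_space k :
  inv_space (prim_space K n k) = (inv_space (hom_space K n k) :&: lker Dm)%VS.
Proof. by rewrite /inv_space /prim_space -!capvA; congr (_ :&: _)%VS; rewrite capvC. Qed.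

(** The graded space to decompose is the space of invariants itself, which both
    operators preserve.                                                       *)
Lemma inv_hom_space_decomposition r :
    [pchar K] =i pred0 -> (r <= m)%N ->
  inv_space (hom_space K n r)
    = (\sum_(j < (minn r (m - r)).+1)
         D_plus_iter K n (r - j) @: inv_space (prim_space K n j))%VS
  /\ directv (\sum_(j < (minn r (m - r)).+1)
         D_plus_iter K n (r - j) @: inv_space (prim_space K n j))%VS.
Proof.
move=> K0 le_rm; pose A k := inv_space (hom_space K n k).
have A_up k v : v \in A k -> Dp v \in A k.+1.
  move=> /memv_inv[Av fix_v]; apply/memv_inv; split; first exact: D_plus_hom.
  by move=> g /fix_v gv; rewrite -D_plus_act gv.
have A_down k v : v \in A k.+1 -> Dm v \in A k.
  move=> /memv_inv[Av fix_v]; apply/memv_inv; split; first exact: D_minus_hom.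
  by move=> g /fix_v gv; rewrite -D_minus_act gv.
have A_bottom v : v \in A 0%N -> Dm v = 0 by move=> /memv_inv[/D_minus_hom0].
have A_top k : (m < k)%N -> A k = 0%VS.
  by move/hom_space_above=> A0; rewrite /A /inv_space A0 cap0v.
have commD k v : v \in A k -> Dm (Dp v) = Dp (Dm v) + (m%:R - k.*2%:R) *: v.
  by move=> /memv_inv[/D_commutator].
have [sumA dxA] := lefschetz_decomposition K0 A_up A_down A_bottom A_top commD le_rm.
split; first by rewrite -/(A r) sumA; apply: eq_bigr => j _; rewrite inv_prim_space.
apply/directv_sum_independent => u Uu; apply: (directv_sum_independent dxA) => j _.
by rewrite -inv_prim_space; apply: Uu.
Qed.

End GraphOperators.

Unset Implicit Arguments.

Theorem theorem5p3 (R : realType) (n r : nat) (hr : (r <= 'C(n, 2))%N) :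
  inv_space (hom_space R[i] n r)
    = (\sum_(j < (minn r ('C(n, 2) - r)).+1)
         D_plus_iter R[i] n (r - j) @: inv_space (prim_space R[i] n j))%VS
  /\ directv (\sum_(j < (minn r ('C(n, 2) - r)).+1)
         D_plus_iter R[i] n (r - j) @: inv_space (prim_space R[i] n j))%VS.
Proof. exact: inv_hom_space_decomposition (Num.Theory.pchar_num _) hr. Qed.
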